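(* For any rooted graph $(G,R)$ and any $x\in U\big(L_{\mathbb{Z}}(G,R)\big)$, we have $x\in \widetilde{DU}\big(L_{\mathbb{Z}}(G,R)\big)$ if and only if there exist a finite maximal basis $B$ of $\mathcal{T}(G,R)$ and elements $\kappa_b\in\{\pm 1\}$ ($b\in B$) such that $$x=\sum_{b\in B}\kappa_b\, bb^*.$$
   Context: Graphs are directed with multiple edges and loops allowed: $G=(VG,EG,o,t)$ with origin and terminus maps $o,t:EG\to VG$. All graphs are locally finite: $|o^{-1}(v)|<\infty$ for every $v\in VG$. A path is either an empty path $\varepsilon_v$ ($v\in VG$) or a word $e_1\dots e_n$ ($n\ge 1$) of edges with $t(e_i)=o(e_{i+1})$. $\mathcal{W}(G)$ is the set of all paths; $O(e_1\dots e_n)=o(e_1)$, $T(e_1\dots e_n)=t(e_n)$, $O(\varepsilon_v)=T(\varepsilon_v)=v$; $\mathcal{W}(G,v)$ is the set of paths $p$ with $O(p)=v$. A rooted graph $(G,R)$ is a graph $G$ with a vertex $R$ (the root) from which every vertex can be reached by a directed path. The unfolding tree $\mathcal{T}(G,R)$ has vertex set $\mathcal{W}(G,R)$ and edges $(p,pe)$. A path $p$ is a prefix of $q$ ($p\preceq q$) if $q=pr$ for some path $r$. A set of paths is independent if none of its elements is a prefix of another one. A finite maximal basis of $\mathcal{T}(G,R)$ is a finite independent subset of $\mathcal{W}(G,R)$ that is inclusion-maximal among independent subsets. The Leavitt path algebra $L_{\mathbb{Z}}(G)$ is the $\mathbb{Z}$-algebra generated by $VG\sqcup\{e,e^*\mid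 e\in EG\}$ with relations: $vw=\delta_{v,w}v$ for $v,w\in VG$; $e^*e'=0$ if $e\ne e'$ and $e^*e=t(e)$; $o(e)e=e\,t(e)=e$; $t(e)e^*=e^*o(e)=e^*$; and $v=\sum_{e\in o^{-1}(v)}ee^*$ whenever $o^{-1}(v)\neq\emptyset$. It has the linear involution $*$ with $(xy)^*=y^*x^*$, $v^*=v$, $(e)^*=e^*$, $(e^* )^*=e$. A path $p=e_1\dots e_n$ is viewed as the product of its edges, $p^*=e_n^*\dots e_1^*$, and $\varepsilon_v=v$. The rooted Leavitt path algebra $L=L_{\mathbb{Z}}(G,R)$ is the $\mathbb{Z}$-submodule of $L_{\mathbb{Z}}(G)$ generated by $\{pq^*\mid p,q\in\mathcal{W}(G,R),\ T(p)=T(q)\}$; it is a $*$-subalgebra with unit $R$. Put $U(L)=\{x\in L\mid xx^*=x^*x=R\}$, $S(L)=\{x\in L\mid x^*=x\}$, and $$\widetilde{DU}(L)=\{x\in U(L)\cap S(L)\mid \forall y\in L\ \exists y_+,y_-\in L:\ y=y_++y_-,\ xy_+=y_+,\ xy_-=-y_-\}.$$ *)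

(* Defs.v *)
From HB Require Import structures.
From mathcomp Require Import all_boot all_order all_algebra finmap.
From mathcomp Require Import boolp classical_sets functions cardinality fsbigop.

Set Implicit Arguments.
Unset Strict Implicit.
Unset Printing Implicit Defensive.

Import GRing.Theory.
Local Open Scope quotient_scope.
Local Open Scope classical_set_scope.
Local Open Scope ring_scope.

(* Directed graphs with loops and multiple edges, locally finite in the sense
   that every vertex emits finitely many edges; the vertex and edge sets may be
   infinite. *)
Record digraph := Digraph {
  vertex : Type;
  edge : Type;
  org : edge -> vertex;
  ter : edge -> vertex;
  locally_finite : forall v : vertex, finite_set (org @^-1` [set v])
}.

(* Classical equality and choice on vertices and edges. *)
HB.instance Definition _ (G : digraph) := gen_eqMixin (vertex G).
HB.instance Definition _ (G : digraph) := gen_choiceMixin (vertex G).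
HB.instance Definition _ (G : digraph) := gen_eqMixin (edge G).
HB.instance Definition _ (G : digraph) := gen_choiceMixin (edge G).

Definition out_edges (G : digraph) (v : vertex G) : seq (edge G) :=
  fset_set (org (d := G) @^-1` [set v]).

Section Paths.
Variable G : digraph.

Fixpoint is_walk (v : vertex G) (s : seq (edge G)) : bool :=
  if s is e :: s' then (org e == v) && is_walk (ter e) s' else true.

(* A path is its origin together with its word of edges: [(v, [::])] is the
   empty path at [v], and for a nonempty word the origin is forced to be that
   of the first edge. *)
Record gpath := GPath {
  gpath_val :> vertex G * seq (edge G);
  gpathP : is_walk gpath_val.1 gpath_val.2
}.

HB.instance Definition _ := [isSub for gpath_val].
HB.instance Definition _ := [Choice of gpath by <:].

Definition word (p : gpath) : seq (edge G) := (gpath_val p).2.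
Definition path_org (p : gpath) : vertex G := (gpath_val p).1.
Definition path_ter (p : gpath) : vertex G :=
  last (path_org p) (map (@ter G) (word p)).

Definition paths_from (v : vertex G) : set gpath := [set p | path_org p = v].

(* [is_cat p r q] says that the composite pr is defined and equal to q. *)
Definition is_cat (p r q : gpath) : Prop :=
  [/\ path_org r = path_ter p, path_org q = path_org p
    & word q = word p ++ word r].

Definition path_prefix (p q : gpath) : Prop := exists r, is_cat p r q.

Definition independent (A : set gpath) : Prop :=
  forall p q, A p -> A q -> path_prefix p q -> p = q.

Definition is_root (R : vertex G) : Prop :=
  forall v, exists2 p, paths_from R p & path_ter p = v.

(* The vertices of the unfolding tree T(G, R) are the elements of
   [paths_from R]. *)
Definition finite_maximal_basis (R : vertex G) (B : set gpath) : Prop :=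
  [/\ finite_set B, B `<=` paths_from R, independent B
    & forall A, A `<=` paths_from R -> independent A -> B `<=` A -> A = B].

(* The Leavitt path algebra over Z, as the (not necessarily unital) ring
   presented by generators and relations: formal expressions in the generators
   modulo the least congruence containing the ring axioms and the relations. *)
Inductive lpa_term : Type :=
| TVertex of vertex G
| TEdge of edge G
| TGhost of edge G
| TZero
| TOpp of lpa_term
| TAdd of lpa_term & lpa_term
| TMul of lpa_term & lpa_term.

Inductive lpa_cong : lpa_term -> lpa_term -> Prop :=
| cong_refl a : lpa_cong a a
| cong_sym a b : lpa_cong a b -> lpa_cong b a
| cong_trans b a c : lpa_cong a b -> lpa_cong b c -> lpa_cong a c
| cong_opp a a' : lpa_cong a a' -> lpa_cong (TOpp a) (TOpp a')
| cong_add a a' b b' : lpa_cong a a' -> lpa_cong b b' ->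
    lpa_cong (TAdd a b) (TAdd a' b')
| cong_mul a a' b b' : lpa_cong a a' -> lpa_cong b b' ->
    lpa_cong (TMul a b) (TMul a' b')
| cong_addA a b c : lpa_cong (TAdd a (TAdd b c)) (TAdd (TAdd a b) c)
| cong_addC a b : lpa_cong (TAdd a b) (TAdd b a)
| cong_add0 a : lpa_cong (TAdd TZero a) a
| cong_addN a : lpa_cong (TAdd (TOpp a) a) TZero
| cong_mulA a b c : lpa_cong (TMul a (TMul b c)) (TMul (TMul a b) c)
| cong_mulDl a b c :
    lpa_cong (TMul (TAdd a b) c) (TAdd (TMul a c) (TMul b c))
| cong_mulDr a b c :
    lpa_cong (TMul a (TAdd b c)) (TAdd (TMul a b) (TMul a c))
| cong_vv v : lpa_cong (TMul (TVertex v) (TVertex v)) (TVertex v)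
| cong_vw v w : v <> w -> lpa_cong (TMul (TVertex v) (TVertex w)) TZero
| cong_ghost_edge e : lpa_cong (TMul (TGhost e) (TEdge e)) (TVertex (ter e))
| cong_ghost_edge0 e f : e <> f -> lpa_cong (TMul (TGhost e) (TEdge f)) TZero
| cong_org_edge e : lpa_cong (TMul (TVertex (org e)) (TEdge e)) (TEdge e)
| cong_edge_ter e : lpa_cong (TMul (TEdge e) (TVertex (ter e))) (TEdge e)
| cong_ter_ghost e : lpa_cong (TMul (TVertex (ter e)) (TGhost e)) (TGhost e)
| cong_ghost_org e : lpa_cong (TMul (TGhost e) (TVertex (org e))) (TGhost e)
| cong_vertex v : org (d := G) @^-1` [set v] !=set0 ->
    lpa_cong (TVertex v)
      (foldr TAdd TZero [seq TMul (TEdge e) (TGhost e) | e <- out_edges v]).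

HB.instance Definition _ := gen_eqMixin lpa_term.
HB.instance Definition _ := gen_choiceMixin lpa_term.

Definition lpa_equiv : rel lpa_term := fun a b => `[< lpa_cong a b >].

Lemma lpa_equiv_refl : reflexive lpa_equiv.
Proof. by move=> a; apply/asboolP; exact: cong_refl. Qed.

Lemma lpa_equiv_sym : symmetric lpa_equiv.
Proof.
by move=> a b; apply/asboolP/asboolP => h; exact: cong_sym.
Qed.

Lemma lpa_equiv_trans : transitive lpa_equiv.
Proof.
move=> b a c /asboolP h1 /asboolP h2; apply/asboolP; exact: cong_trans h2.
Qed.

Canonical lpa_equiv_rel :=
  EquivRel lpa_equiv lpa_equiv_refl lpa_equiv_sym lpa_equiv_trans.

Definition lpa := {eq_quot lpa_equiv}.

HB.instance Definition _ := Choice.on lpa.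
HB.instance Definition _ := Quotient.on lpa.

Definition lpa_zero : lpa := \pi_lpa TZero.
Definition lpa_opp (x : lpa) : lpa := \pi_lpa (TOpp (repr x)).
Definition lpa_add (x y : lpa) : lpa := \pi_lpa (TAdd (repr x) (repr y)).
Definition lpa_mul (x y : lpa) : lpa := \pi_lpa (TMul (repr x) (repr y)).

Lemma lpa_eqP a b : \pi_lpa a = \pi_lpa b <-> lpa_cong a b.
Proof.
split=> [/eqP|h]; first by rewrite eqmodE => /asboolP.
by apply/eqP; rewrite eqmodE; apply/asboolP.
Qed.

Lemma lpa_reprK a : lpa_cong (repr (\pi_lpa a)) a.
Proof. by apply/lpa_eqP; rewrite reprK. Qed.

Lemma lpa_oppE a : lpa_opp (\pi_lpa a) = \pi_lpa (TOpp a).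
Proof. by apply/lpa_eqP/cong_opp/lpa_reprK. Qed.

Lemma lpa_addE a b : lpa_add (\pi_lpa a) (\pi_lpa b) = \pi_lpa (TAdd a b).
Proof. by apply/lpa_eqP/cong_add; exact: lpa_reprK. Qed.

Lemma lpa_mulE a b : lpa_mul (\pi_lpa a) (\pi_lpa b) = \pi_lpa (TMul a b).
Proof. by apply/lpa_eqP/cong_mul; exact: lpa_reprK. Qed.

Lemma lpa_addA : associative lpa_add.
Proof.
elim/quotW=> a; elim/quotW=> b; elim/quotW=> c.
rewrite (lpa_addE b c) (lpa_addE a b) !lpa_addE.
by apply/lpa_eqP; exact: cong_addA.
Qed.

Lemma lpa_addC : commutative lpa_add.
Proof.
by elim/quotW=> a; elim/quotW=> b; rewrite !lpa_addE; apply/lpa_eqP; exact: cong_addC.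
Qed.

Lemma lpa_add0 : left_id lpa_zero lpa_add.
Proof. by elim/quotW=> a; rewrite lpa_addE; apply/lpa_eqP; exact: cong_add0. Qed.

Lemma lpa_addN : left_inverse lpa_zero lpa_opp lpa_add.
Proof.
by elim/quotW=> a; rewrite lpa_oppE lpa_addE; apply/lpa_eqP; exact: cong_addN.
Qed.

HB.instance Definition _ :=
  GRing.isZmodule.Build lpa lpa_addA lpa_addC lpa_add0 lpa_addN.

Lemma lpa_mulA : associative lpa_mul.
Proof.
elim/quotW=> a; elim/quotW=> b; elim/quotW=> c.
rewrite (lpa_mulE b c) (lpa_mulE a b) !lpa_mulE.
by apply/lpa_eqP; exact: cong_mulA.
Qed.

Lemma lpa_mulDl : left_distributive lpa_mul +%R.
Proof.
elim/quotW=> a; elim/quotW=> b; elim/quotW=> c.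
rewrite [_ + _](lpa_addE a b) (lpa_mulE a c) (lpa_mulE b c) lpa_mulE.
by rewrite [RHS]lpa_addE; apply/lpa_eqP; exact: cong_mulDl.
Qed.

Lemma lpa_mulDr : right_distributive lpa_mul +%R.
Proof.
elim/quotW=> a; elim/quotW=> b; elim/quotW=> c.
rewrite [_ + _](lpa_addE b c) (lpa_mulE a b) (lpa_mulE a c) lpa_mulE.
by rewrite [RHS]lpa_addE; apply/lpa_eqP; exact: cong_mulDr.
Qed.

Definition lpa_vertex (v : vertex G) : lpa := \pi_lpa (TVertex v).
Definition lpa_edge (e : edge G) : lpa := \pi_lpa (TEdge e).

Fixpoint term_star (a : lpa_term) : lpa_term :=
  match a with
  | TVertex v => TVertex v
  | TEdge e => TGhost e
  | TGhost e => TEdge e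
  | TZero => TZero
  | TOpp a => TOpp (term_star a)
  | TAdd a b => TAdd (term_star a) (term_star b)
  | TMul a b => TMul (term_star b) (term_star a)
  end.

Lemma term_star_cong a b : lpa_cong a b -> lpa_cong (term_star a) (term_star b).
Proof.
elim=> {a b}; try by [move=> *; constructor].
- by move=> b a c _ h1 _ h2; exact: cong_trans h2.
- by move=> a b c /=; apply: cong_sym; exact: cong_mulA.
- by move=> v w vw /=; apply: cong_vw => wv; apply: vw.
- by move=> e f ef /=; apply: cong_ghost_edge0 => fe; apply: ef.
- move=> v /cong_vertex h /=.
  suff -> : term_star (foldr TAdd TZero
      [seq TMul (TEdge e) (TGhost e) | e <- out_edges v]) =
    foldr TAdd TZero [seq TMul (TEdge e) (TGhost e) | e <- out_edges v] by [].
  by elim: (out_edges v) => //= e s ->.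
Qed.

Definition lpa_star (x : lpa) : lpa := \pi_lpa (term_star (repr x)).

Lemma lpa_starE a : lpa_star (\pi_lpa a) = \pi_lpa (term_star a).
Proof. by apply/lpa_eqP/term_star_cong/lpa_reprK. Qed.

Fixpoint lpa_word (e : edge G) (s : seq (edge G)) : lpa :=
  if s is f :: s' then lpa_mul (lpa_edge e) (lpa_word f s') else lpa_edge e.

Definition lpa_path (p : gpath) : lpa :=
  if word p is e :: s then lpa_word e s else lpa_vertex (path_org p).

End Paths.

Declare Scope lpa_scope.
Delimit Scope lpa_scope with lpa.
Notation "x * y" := (lpa_mul x y) : lpa_scope.
Notation "x ^*" := (lpa_star x) : lpa_scope.

Section RootedLpa.
Variables (G : digraph) (R : vertex G).

Definition is_submodule (M : set (lpa G)) : Prop :=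
  M 0 /\ forall x y, M x -> M y -> M (x - y).

(* The carrier of L_Z(G, R); its unit is [lpa_vertex R]. *)
Definition rlpa : set (lpa G) :=
  smallest is_submodule
    [set x | exists p q, [/\ paths_from R p, paths_from R q,
       path_ter p = path_ter q & x = (lpa_path p * (lpa_path q)^*)%lpa]].

Definition unitary : set (lpa G) :=
  [set x | [/\ rlpa x, (x * x^*)%lpa = lpa_vertex R
             & (x^* * x)%lpa = lpa_vertex R]].

Definition selfadjoint : set (lpa G) := [set x | rlpa x /\ (x^*)%lpa = x].

Definition diag_unitary : set (lpa G) :=
  [set x | (unitary `&` selfadjoint) x /\
     forall y, rlpa y -> exists yp ym, [/\ rlpa yp, rlpa ym, y = yp + ym,
       (x * yp)%lpa = yp & (x * ym)%lpa = - ym]].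

End RootedLpa.

(* Main.v *)
Require Import Defs.
From HB Require Import structures.
From mathcomp Require Import all_boot all_order all_algebra finmap.
From mathcomp Require Import boolp classical_sets functions cardinality fsbigop.
From mathcomp Require Import zify ring.

(* If x is a diagonal unitary, the decomposition of y = R gives x = 2P - R with
   P in L. Cutting the unfolding tree deep enough yields a finite
   maximal basis B such that for every b in B the element Pb is an integral
   combination of paths ending at T(b), hence so is xb = 2Pb - b. The degree 0
   part of (xb)^*(xb) = T(b) says that the squares of the coefficients of xb sum
   to 1, and the coefficient of b is odd, so xb = b or xb = -b. As the sum of the
   bb^* is R, x has the required form. That T(b) is torsion-free and independent
   of closed paths is seen in a representation of L_Z(G) on functions of a
   boundary path and a degree.
   Conversely xx^* = R forces the sum of the orthogonal projections bb^* to be R,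
   and y_+, y_- are obtained by splitting this sum according to signs. *)

Set Implicit Arguments.
Unset Strict Implicit.
Unset Printing Implicit Defensive.
Import Order.TTheory GRing.Theory Num.Theory.
Local Open Scope quotient_scope.
Local Open Scope classical_set_scope.
Local Open Scope ring_scope.

(** * Additivity of the operations and the defining relations of the Leavitt path algebra *)

Section LpaAlgebra.
Variable G : digraph.
Implicit Types (x y z : lpa G) (v : vertex G) (e f : edge G).

Lemma lpa_mul_is_additive x : zmod_morphism (lpa_mul x).
Proof.
move=> y z; apply: (@addIr _ (lpa_mul x z)).
by rewrite -lpa_mulDr !subrK.
Qed.
HB.instance Definition _ x :=
  GRing.isZmodMorphism.Build (lpa G) (lpa G) (lpa_mul x) (lpa_mul_is_additive x).

(** Right multiplication as a function of its own, so that additivity can be attached to it. *)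
Definition lpa_mulr x y := lpa_mul y x.

Lemma lpa_mulr_is_additive x : zmod_morphism (lpa_mulr x).
Proof.
move=> y z; apply: (@addIr _ (lpa_mul z x)).
by rewrite /lpa_mulr -lpa_mulDl !subrK.
Qed.
HB.instance Definition _ x :=
  GRing.isZmodMorphism.Build (lpa G) (lpa G) (lpa_mulr x) (lpa_mulr_is_additive x).

Lemma lpa_mul0 x : (x * 0)%lpa = 0. Proof. exact: raddf0. Qed.
Lemma lpa_0mul x : (0 * x)%lpa = 0. Proof. exact: (raddf0 (lpa_mulr x)). Qed.

Lemma lpa_mulBr x y z : (x * (y - z))%lpa = (x * y)%lpa - (x * z)%lpa.
Proof. exact: raddfB. Qed.
Lemma lpa_mulBl x y z : ((x - y) * z)%lpa = (x * z)%lpa - (y * z)%lpa.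
Proof. exact: (raddfB (lpa_mulr z)). Qed.

Lemma lpa_mulMz x y n : (x * (y *~ n))%lpa = (x * y)%lpa *~ n.
Proof. exact: raddfMz. Qed.
Lemma lpa_Mzmul x y n : ((x *~ n) * y)%lpa = (x * y)%lpa *~ n.
Proof. exact: (raddfMz (lpa_mulr y)). Qed.

Lemma lpa_mul_sumr (I : Type) (r : seq I) (P : pred I) (F : I -> lpa G) x :
  (x * \sum_(i <- r | P i) F i)%lpa = \sum_(i <- r | P i) (x * F i)%lpa.
Proof. exact: raddf_sum. Qed.
Lemma lpa_mul_suml (I : Type) (r : seq I) (P : pred I) (F : I -> lpa G) x :
  ((\sum_(i <- r | P i) F i) * x)%lpa = \sum_(i <- r | P i) (F i * x)%lpa.
Proof. exact: (raddf_sum (lpa_mulr x)). Qed.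

Lemma lpa_star_is_additive : zmod_morphism (@lpa_star G).
Proof.
move=> y z; apply: (@addIr _ (lpa_star z)).
rewrite subrK -[in RHS](subrK z y); move: (y - z).
elim/quotW=> a; elim/quotW: z => b.
have -> : \pi_(lpa G) a + \pi_(lpa G) b = \pi_(lpa G) (TAdd a b).
  exact: lpa_addE.
by rewrite !lpa_starE; exact: lpa_addE.
Qed.
HB.instance Definition _ :=
  GRing.isZmodMorphism.Build (lpa G) (lpa G) (@lpa_star G) lpa_star_is_additive.

Lemma lpa_starM x y : ((x * y)^* = y^* * x^*)%lpa.
Proof.
elim/quotW: x => a; elim/quotW: y => b.
by rewrite lpa_mulE !lpa_starE lpa_mulE.
Qed.

Lemma lpa_starK x : (x^*^*)%lpa = x.
Proof.
elim/quotW: x => a; rewrite (lpa_starE a) lpa_starE; congr (\pi _).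
by elim: a => //= [a ->|a -> b ->|a -> b ->].
Qed.

Lemma lpa_star_vertex v : ((lpa_vertex v)^* = lpa_vertex v)%lpa.
Proof. by rewrite lpa_starE. Qed.

Lemma lpa_vertexK v : (lpa_vertex v * lpa_vertex v)%lpa = lpa_vertex v.
Proof. by rewrite lpa_mulE; apply/lpa_eqP; exact: cong_vv. Qed.

Lemma lpa_star_edgeK e : ((lpa_edge e)^* * lpa_edge e)%lpa = lpa_vertex (ter e).
Proof. by rewrite lpa_starE lpa_mulE; apply/lpa_eqP; exact: cong_ghost_edge. Qed.

Lemma lpa_star_edge0 e f : e != f -> ((lpa_edge e)^* * lpa_edge f)%lpa = 0.
Proof.
move=> /eqP ef; rewrite lpa_starE lpa_mulE.
by apply/lpa_eqP; exact: cong_ghost_edge0.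
Qed.

Lemma lpa_org_edge e : (lpa_vertex (org e) * lpa_edge e)%lpa = lpa_edge e.
Proof. by rewrite lpa_mulE; apply/lpa_eqP; exact: cong_org_edge. Qed.

Lemma lpa_edge_ter e : (lpa_edge e * lpa_vertex (ter e))%lpa = lpa_edge e.
Proof. by rewrite lpa_mulE; apply/lpa_eqP; exact: cong_edge_ter. Qed.

Lemma mem_out_edges v e : (e \in out_edges v) = (org e == v).
Proof.
rewrite /out_edges in_fset_set; last exact: locally_finite.
by apply/idP/eqP; rewrite inE.
Qed.

Lemma lpa_vertex_sum v : out_edges v != [::] ->
  lpa_vertex v = \sum_(e <- out_edges v) (lpa_edge e * (lpa_edge e)^*)%lpa.
Proof.
move=> v0; transitivity (\pi_(lpa G) (foldr (@TAdd G) (TZero G)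
    [seq TMul (TEdge e) (TGhost e) | e <- out_edges v])).
  apply/lpa_eqP/cong_vertex.
  case: (out_edges v) (@mem_out_edges v) v0 => // e s h _.
  by exists e; apply/eqP; rewrite -h inE eqxx.
elim: (out_edges v) => [|e s ih] /=; first by rewrite big_nil.
by rewrite big_cons -ih lpa_starE lpa_mulE [RHS]lpa_addE.
Qed.

End LpaAlgebra.

(** * Monomials of walks and the cuts of the unfolding tree *)

Section Walks.
Variable G : digraph.
Implicit Types (v : vertex G) (e f : edge G) (s t r : seq (edge G)).

Definition walk_end v s : vertex G := last v (map (@ter G) s).

Lemma walk_end_cat v s t : walk_end v (s ++ t) = walk_end (walk_end v s) t.
Proof. by rewrite /walk_end map_cat last_cat. Qed.

Lemma is_walk_cat v s t :
  is_walk v (s ++ t) = is_walk v s && is_walk (walk_end v s) t.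
Proof. by elim: s v => //= e s ih v; rewrite ih andbA. Qed.

(** Unlike [lpa_word], the product ends in a vertex for every word, so that inductions can start
    from the empty word. *)
Fixpoint walk_mono v s : lpa G :=
  if s is e :: s' then (lpa_edge e * walk_mono (ter e) s')%lpa else lpa_vertex v.

Lemma lpa_pathE (p : gpath G) : lpa_path p = walk_mono (path_org p) (word p).
Proof.
rewrite /lpa_path; case: (word p) => //= e s.
elim: s e => [|f s ih] e /=; first by rewrite lpa_edge_ter.
by rewrite ih.
Qed.

Lemma walk_mono_org v s : is_walk v s ->
  (lpa_vertex v * walk_mono v s)%lpa = walk_mono v s.
Proof.
case: s => [|e s] /=; first by rewrite lpa_vertexK.
by case/andP=> /eqP <- _; rewrite lpa_mulA lpa_org_edge.
Qed.

Lemma walk_mono_cat v s t : is_walk v (s ++ t) ->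
  (walk_mono v s * walk_mono (walk_end v s) t)%lpa = walk_mono v (s ++ t).
Proof.
elim: s v => [|e s ih] v /=; first exact: walk_mono_org.
by case/andP=> _ /ih {}ih; rewrite -lpa_mulA ih.
Qed.

(** The relations for $e^*f$ cancel equal first edges one pair at a time, until the words differ or
    one of them is exhausted. *)
Lemma walk_mono_starM v s t : is_walk v s -> is_walk v t ->
  [\/ exists2 r, t = s ++ r &
        ((walk_mono v s)^* * walk_mono v t)%lpa = walk_mono (walk_end v s) r,
      exists2 r, s = t ++ r &
        ((walk_mono v s)^* * walk_mono v t = (walk_mono (walk_end v t) r)^*)%lpa
    | ((walk_mono v s)^* * walk_mono v t)%lpa = 0].
Proof.
elim: s v t => [|e s ih] v t ws wt.
  by apply: Or31; exists t; rewrite //= lpa_star_vertex walk_mono_org.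
case: t wt => [|f t] wt.
  apply: Or32; exists (e :: s) => //; rewrite -[walk_mono v [::]]lpa_starK.
  by rewrite -lpa_starM [walk_mono v [::]]/= lpa_star_vertex walk_mono_org.
move: ws wt => /= /andP[_ ws] /andP[_ wt].
rewrite lpa_starM -lpa_mulA (lpa_mulA (lpa_edge e)^*%lpa).
have [ef|ef] := eqVneq e f; last first.
  by apply: Or33; rewrite lpa_star_edge0 // lpa_0mul lpa_mul0.
rewrite -ef in wt *; rewrite lpa_star_edgeK walk_mono_org //.
case: (ih _ _ ws wt) => [[r -> ->]|[r -> ->]|->].
- by apply: Or31; exists r.
- by apply: Or32; exists r.
- exact: Or33.
Qed.

Lemma walk_mono_starK v s : is_walk v s ->
  ((walk_mono v s)^* * walk_mono v s)%lpa = lpa_vertex (walk_end v s).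
Proof.
elim: s v => [|e s ih] v /=; first by rewrite lpa_star_vertex lpa_vertexK.
case/andP=> _ ws; rewrite lpa_starM -lpa_mulA (lpa_mulA (lpa_edge e)^*%lpa).
by rewrite lpa_star_edgeK walk_mono_org // ih.
Qed.

(* The words of the maximal basis that cuts the unfolding tree at depth [N]:
   walks of length [N], and shorter walks ending in a sink. *)
Fixpoint cut (N : nat) v : seq (seq (edge G)) :=
  if N is N'.+1 then
    if out_edges v is [::] then [:: [::]]
    else flatten [seq map (cons e) (cut N' (ter e)) | e <- out_edges v]
  else [:: [::]].

Variant cutS_spec N v : seq (seq (edge G)) -> Prop :=
| CutSink : (forall e, org e <> v) -> cutS_spec N v [:: [::]]
| CutStep : out_edges v != [::] ->
   cutS_spec N v (flatten [seq map (cons e) (cut N (ter e)) | e <- out_edges v]).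

Lemma cutSP N v : cutS_spec N v (cut N.+1 v).
Proof.
have [h|h] := eqVneq (out_edges v) [::].
  by rewrite /= h; apply: CutSink => e /eqP; rewrite -mem_out_edges h.
suff -> : cut N.+1 v =
    flatten [seq map (cons e) (cut N (ter e)) | e <- out_edges v].
  exact: CutStep.
by move=> /=; case: (out_edges v) h.
Qed.

Lemma cut_walk N v s : s \in cut N v -> is_walk v s.
Proof.
elim: N v s => [|N ih] v s; first by rewrite inE => /eqP ->.
case: cutSP => _; first by rewrite inE => /eqP ->.
move=> /flatten_mapP[e eo /mapP[t tN ->]] /=.
by rewrite -mem_out_edges eo ih.
Qed.

(** A word of the cut has length [N] or ends in a sink. In the first case there is no room for [t],
    in the second no edge can follow. The alternative on the size allows a comparison with any short
    path, the other one with a second word of the cut. *)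
Lemma cut_prefix_free N v s t :
  is_walk v (s ++ t) -> (size (s ++ t) <= N)%N \/ s ++ t \in cut N v ->
  s \in cut N v -> t = [::].
Proof.
elim: N v s => [|N ih] v s ws h.
  rewrite inE => /eqP s0; move: h; rewrite s0 /= leqn0 inE.
  by case: (t) => // e t' [].
case: cutSP h ws => [sv h ws|ne h ws].
  rewrite inE => /eqP s0; move: ws; rewrite s0 /=.
  by case: (t) => // e t' /= /andP[/eqP /sv].
move=> /flatten_mapP[e eo /mapP[s' sN es]]; rewrite {}es in ws h *.
move: ws => /= /andP[_ ws].
apply: ih ws _ sN; case: h => [h|]; first by left.
by move=> /flatten_mapP[f fo /mapP[t' tN [-> ->]]]; right.
Qed.

(** A walk either passes through a word of the cut or stops earlier and can be continued to one.
    This gives the maximality of the cut. *)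
Lemma cut_comparable N v s : is_walk v s ->
  exists2 t, t \in cut N v & exists r, s = t ++ r \/ t = s ++ r.
Proof.
elim: N v s => [|N ih] v s ws.
  by exists [::] => //; exists s; left.
case: cutSP => [sv|ne]; first by exists [::]; rewrite ?inE //; exists s; left.
case: s ws => [_|e s /= /andP[/eqP oe ws]].
  case: (out_edges v) ne => // e s _; have [t tN _] := ih (ter e) [::] isT.
  exists (e :: t); last by exists (e :: t); right.
  by rewrite /= mem_cat map_f.
have [t tN [r rP]] := ih _ _ ws.
exists (e :: t); last by exists r; case: rP => ->; [left|right].
apply/flatten_mapP; exists e; first by rewrite mem_out_edges oe.
exact: map_f.
Qed.

Lemma cut_uniq N v : uniq (cut N v).
Proof.
elim: N v => // N ih v; case: cutSP => // _.
have : uniq (out_edges v) by exact: fset_uniq.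
elim: (out_edges v) => //= e s IH /andP[es us].
rewrite cat_uniq (IH us) andbT map_inj_uniq ?ih; last by move=> a b [].
apply/hasPn => t /flatten_mapP[f fs /mapP[t' _ ->]].
by apply/mapP => -[t'' _ [fe _]]; rewrite -fe fs in es.
Qed.

(** Iterates the relation $v=\sum ee^*$ at every vertex that emits an edge and is reached before
    depth [N]. *)
Lemma cut_sum N v :
  \sum_(s <- cut N v) (walk_mono v s * (walk_mono v s)^*)%lpa = lpa_vertex v.
Proof.
elim: N v => [|N ih] v.
  by rewrite big_seq1 /= lpa_star_vertex lpa_vertexK.
case: cutSP => [_|ne]; first by rewrite big_seq1 /= lpa_star_vertex lpa_vertexK.
rewrite lpa_vertex_sum // big_flatten big_map; apply: eq_bigr => e _.
rewrite big_map /= -[X in (X * _)%lpa](lpa_edge_ter e) -(ih (ter e)).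
rewrite lpa_mul_sumr lpa_mul_suml; apply: eq_bigr => s _.
by rewrite lpa_starM !lpa_mulA.
Qed.

End Walks.

(** * The action on functions of a boundary path and a degree *)

Section Representation.
Variable G : digraph.
Implicit Types (v : vertex G) (e : edge G) (s t : seq (edge G)).

(* A boundary path is an infinite path, or a finite path ending in a sink [v],
   padded with [inr v]. *)
Definition letter : Type := (edge G + vertex G)%type.

Definition letter_org (l : letter) :=
  match l with inl e => org e | inr v => v end.
Definition letter_ter (l : letter) :=
  match l with inl e => ter e | inr v => v end.

Definition boundary (w : nat -> letter) : Prop := forall n,
  letter_ter (w n) = letter_org (w n.+1) /\
  forall v, w n = inr v -> forall e, org e <> v.

Definition shift (w : nat -> letter) (n : nat) := w n.+1.
Definition scons (l : letter) (w : nat -> letter) (n : nat) :=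
  if n is m.+1 then w m else l.

Lemma scons_shift w : scons (w 0) (shift w) = w.
Proof. by apply/funext; case. Qed.

Lemma boundary_shift w : boundary w -> boundary (shift w).
Proof. by move=> bw n; exact: bw. Qed.

Lemma boundary_scons e w : boundary w -> letter_org (w 0) = ter e ->
  boundary (scons (inl e) w).
Proof. by move=> bw we [|n] //=; exact: bw. Qed.

(** At each vertex choose an outgoing edge, or the padding letter at a sink, and iterate the
    choice. *)
Lemma boundary_exists v : exists2 w, boundary w & letter_org (w 0) = v.
Proof.
have /choice[next nextP] (u : vertex G) : exists l : letter,
    letter_org l = u /\ forall u', l = inr u' -> forall e, org e <> u'.
  have [[e eu]|ne] := pselect (exists e : edge G, org e = u).
    by exists (inl e).
  by exists (inr u); split=> // _ [<-] e eu; apply: ne; exists e.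
pose w n := next (iter n (fun u => letter_ter (next u)) v).
exists w; last exact: (nextP v).1.
by move=> n; split; [rewrite (nextP _).1|exact: (nextP _).2].
Qed.

Definition boundary_fun := (nat -> letter) -> int -> int.

(* The integer argument records the degree, which makes closed paths act
   without fixed points. *)
Fixpoint act (a : lpa_term G) (f : boundary_fun) : boundary_fun :=
  match a with
  | TVertex v => fun w n =>
      if `[< boundary w /\ letter_org (w 0) = v >] then f w n else 0
  | TEdge e => fun w n =>
      if `[< boundary w /\ w 0 = inl e >] then f (shift w) (n - 1) else 0
  | TGhost e => fun w n =>
      if `[< boundary w /\ letter_org (w 0) = ter e >]
      then f (scons (inl e) w) (n + 1) else 0
  | TZero => fun _ _ => 0
  | TOpp a => fun w n => - act a f w n
  | TAdd a b => fun w n => act a f w n + act b f w n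
  | TMul a b => act a (act b f)
  end.

(** Additivity of each operator is what the relation $a(b+c)=ab+ac$ requires. *)
Lemma actD a f g w n :
  act a (fun w n => f w n + g w n) w n = act a f w n + act a g w n.
Proof.
elim: a f g w n => /= [v|e|e||a ih|a iha b ihb|a iha b ihb] f g w n.
- by case: ifP => // _; rewrite addr0.
- by case: ifP => // _; rewrite addr0.
- by case: ifP => // _; rewrite addr0.
- by rewrite addr0.
- by rewrite ih opprD.
- by rewrite iha ihb addrACA.
- rewrite -iha; congr (act a _ w n).
  by apply/funext => w'; apply/funext => n'; exact: ihb.
Qed.

Lemma act_sum (I : Type) (r : seq I) (F : I -> lpa_term G) f w n :
  act (foldr (@TAdd G) (TZero G) [seq F i | i <- r]) f w n =
  \sum_(i <- r) act (F i) f w n.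
Proof.
by elim: r => [|i r ih] /=; rewrite ?big_nil ?big_cons ?ih.
Qed.

(** The relations are checked pointwise. The one for a vertex that emits edges holds because a
    boundary path starting there begins with exactly one of them. *)
Lemma act_cong a b : lpa_cong a b -> act a = act b.
Proof.
elim=> {a b} //=.
- by move=> a b c _ -> _ ->.
- by move=> a a' _ ->.
- by move=> a a' b b' _ -> _ ->.
- by move=> a a' b b' _ -> _ ->.
all: move=> *; apply/funext => f; apply/funext => w; apply/funext => n /=.
- by rewrite addrA.
- by rewrite addrC.
- by rewrite add0r.
- by rewrite addNr.
- by rewrite actD.
- by case: asboolP.
- do 2![case: asboolP => //] => -[_ h1] [_ h2]; exfalso; congruence.
- case: asboolP => // -[bw h]; rewrite asboolT ?addrK //.
  by split=> //; exact: boundary_scons.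
- case: asboolP => // -[bw h]; case: asboolP => // -[_ [h']]; contradiction.
- case: asboolP => // h; case: asboolP => // -[bw we].
  by case: h; rewrite we.
- case: asboolP => [[bw h]|h] //; case: asboolP => [[_ h']|] //; case.
  by split; [exact: boundary_shift|have [<- _] := bw 0%N; rewrite h].
- by case: asboolP.
- case: asboolP => [[bw h]|h] //; case: asboolP => [[_ h']|] //; case.
  by split=> //; exact: boundary_scons.
- rewrite act_sum; case: asboolP => [[bw wv]|nw]; last first.
    rewrite big_seq big1 // => e; rewrite mem_out_edges => /eqP ev /=.
    case: asboolP => // -[bw we]; case: nw; split=> //.
    by rewrite we.
  (* A padding letter is excluded, since it occurs only at sinks. *)
  case we : (w 0%N) wv => [e|u] /= ev; last first.
    match goal with H : _ !=set0 |- _ => case: H => e /= eu end.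
    by case: (bw 0%N) => _ /(_ _ we e); rewrite ev eu.
  rewrite (bigD1_seq e) /= ?mem_out_edges ?ev ?eqxx //; last exact: fset_uniq.
  rewrite big1 ?addr0 => [|e' /eqP e'e].
    rewrite asboolT // asboolT.
      by rewrite -we scons_shift subrK.
    by split; [exact: boundary_shift|have [<- _] := bw 0%N; rewrite we].
  by case: asboolP => // -[_]; rewrite we => -[ee']; case: e'e.
Qed.

Definition lpa_act (x : lpa G) := act (repr x).

Lemma lpa_act_pi a : lpa_act (\pi_(lpa G) a) = act a.
Proof. exact/act_cong/lpa_reprK. Qed.

Lemma lpa_actM x y f : lpa_act (x * y)%lpa f = lpa_act x (lpa_act y f).
Proof.
elim/quotW: x => a; elim/quotW: y => b.
by rewrite lpa_mulE !lpa_act_pi.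
Qed.

Definition degree0 : boundary_fun := fun _ n => (n == 0)%:R.

(** Each edge of the walk lowers the degree by one, so [degree0] is evaluated at negative degrees
    only. *)
Lemma act_walk_neg v s w n : n < 0 -> lpa_act (walk_mono v s) degree0 w n = 0.
Proof.
elim: s v w n => [|e s ih] v w n n0 /=.
  by rewrite lpa_act_pi /= /degree0 lt_eqF // if_same.
by rewrite lpa_actM lpa_act_pi /=; case: ifP => // _; rewrite ih //; lia.
Qed.

Definition walk_cat s (w : nat -> letter) := foldr (fun e => scons (inl e)) w s.

Lemma walk_cat_boundary v s w : is_walk v s -> boundary w ->
  letter_org (w 0) = walk_end v s ->
  boundary (walk_cat s w) /\ letter_org (walk_cat s w 0) = v.
Proof.
elim: s v => // e s ih v /= /andP[/eqP ev ws] bw we.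
by have [? ?] := ih _ ws bw we; split=> //; exact: boundary_scons.
Qed.

(** The edges of [t] strip equal letters from [s], each lowering the degree by one. If one word is
    exhausted before the other, the remaining degree is nonzero, even when [w] itself would continue
    the match. *)
Lemma act_walk v u s t w : is_walk v s -> is_walk u t -> boundary w ->
  letter_org (w 0) = walk_end v s -> walk_end u t = walk_end v s ->
  lpa_act (walk_mono u t) degree0 (walk_cat s w) (size s)%:Z = (s == t)%:R.
Proof.
elim: t u v s => [|f t ih] u v s ws wt bw we st /=.
  rewrite lpa_act_pi /= /degree0; case: s ws we st => [|e s] ws we st /=.
    by rewrite asboolT // we -st.
  by rewrite if_same.
rewrite lpa_actM lpa_act_pi /=.
case: s ws we st => [|e s] ws we st /=.
  by case: ifP => // _; rewrite act_walk_neg.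
have [bs so] := walk_cat_boundary ws bw we.
move: ws wt => /= /andP[_ ws] /andP[_ wt].
have [ef|ef] := eqVneq e f; last first.
  case: asboolP => [[_ [/eqP]]|_]; first by rewrite (negbTE ef).
  by rewrite eqseq_cons (negbTE ef).
rewrite -ef in wt st *.
rewrite asboolT // -[shift _]/(walk_cat s w) eqseq_cons eqxx /=.
have -> : (size s).+1%:Z - 1 = (size s)%:Z by lia.
exact: (ih (ter e) (ter e)).
Qed.

(** Ghost edges prepend a letter and raise the degree; the star reverses their order, so [s] is
    prepended as a word. *)
Lemma act_star_walk v s f w n : is_walk v s -> boundary w ->
  letter_org (w 0) = walk_end v s ->
  lpa_act (walk_mono v s)^*%lpa f w n = f (walk_cat s w) (n + (size s)%:Z).
Proof.
elim: s v f n => [|e s ih] v f n /=.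
  by rewrite lpa_star_vertex lpa_act_pi addr0 /= => _ bw we; rewrite asboolT.
case/andP=> _ ws bw we; have [bs so] := walk_cat_boundary ws bw we.
rewrite lpa_starM lpa_actM ih // lpa_starE lpa_act_pi /= asboolT //.
by congr f; lia.
Qed.

(** Apply $x$ to [degree0] and evaluate at $(w,0)$, where $w$ is a boundary path starting at $v$.
    Then $p^*$ moves the evaluation to $(pw,|p|)$, where $q$ gives 1 or 0. Thus the paths ending at
    $v$ behave like an orthonormal family. *)
Lemma vertex_trace v : exists tau : {additive lpa G -> int},
  forall p q : gpath G, path_ter p = v -> path_ter q = v ->
    tau ((lpa_path p)^* * lpa_path q)%lpa = (p == q)%:R.
Proof.
have [w bw wv] := boundary_exists v.
pose tau x := lpa_act x degree0 w 0.
have tauD x y : tau (x + y) = tau x + tau y.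
  rewrite /tau; elim/quotW: x => a; elim/quotW: y => b.
  have -> : \pi_(lpa G) a + \pi_(lpa G) b = \pi_(lpa G) (TAdd a b).
    exact: lpa_addE.
  by rewrite !lpa_act_pi.
have tauB : zmod_morphism tau.
  by move=> x y; apply: (@addIr _ (tau y)); rewrite -tauD !subrK.
pose tauM := GRing.isZmodMorphism.Build _ _ tau tauB.
pose tauA : {additive lpa G -> int} := HB.pack tau tauM.
exists tauA => p q pv qv; rewrite /= /tau lpa_actM !lpa_pathE.
have wp := gpathP p; have wq := gpathP q.
rewrite act_star_walk //; last by rewrite wv -pv.
rewrite add0r (act_walk (v := path_org p)) //; first last.
- by rewrite -[LHS]/(path_ter q) -[RHS]/(path_ter p) pv qv.
- by rewrite wv -pv.
(* Equal words give equal paths here: a nonempty word fixes its origin, and an empty path has its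
   origin at its terminus $v$. *)
congr (nat_of_bool _)%:R; apply/eqP/eqP => [pq|-> //].
apply: val_inj; rewrite /= (surjective_pairing (gpath_val p)).
rewrite (surjective_pairing (gpath_val q)); congr pair; last exact: pq.
move: wp wq; rewrite -[(gpath_val p).2]/(word p) -[(gpath_val q).2]/(word q) pq.
case qs : (word q) => [|e s] /=; last by move=> /andP[/eqP <- _] /andP[/eqP <- _].
move: pv qv; rewrite /path_ter pq qs /= => pv qv _ _.
by rewrite -[LHS]/(path_org p) pv -qv.
Qed.

End Representation.

(** * Products of paths, their integral combinations and the sign of an isometry *)

Section Paths.
Variable G : digraph.
Implicit Types (p q r b c : gpath G) (x y z : lpa G).

Lemma lpa_path_org p : (lpa_vertex (path_org p) * lpa_path p)%lpa = lpa_path p.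
Proof. by rewrite lpa_pathE walk_mono_org //; exact: (gpathP p). Qed.

Lemma lpa_path_ter p : (lpa_path p * lpa_vertex (path_ter p))%lpa = lpa_path p.
Proof.
have wp : is_walk (path_org p) (word p ++ [::]) by rewrite cats0; exact: (gpathP p).
by have := walk_mono_cat wp; rewrite cats0 -lpa_pathE.
Qed.

Lemma lpa_path_starK p :
  ((lpa_path p)^* * lpa_path p)%lpa = lpa_vertex (path_ter p).
Proof. by rewrite lpa_pathE walk_mono_starK //; exact: (gpathP p). Qed.

Lemma path_cat_exists p r : path_org r = path_ter p -> exists q, is_cat p r q.
Proof.
move=> rp; have wq : is_walk (path_org p) (word p ++ word r).
  rewrite is_walk_cat (gpathP p) /= -[walk_end _ _]/(path_ter p) -rp.
  exact: (gpathP r).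
by exists (@GPath G (path_org p, word p ++ word r) wq).
Qed.

Lemma path_catM p r q : is_cat p r q -> (lpa_path p * lpa_path r)%lpa = lpa_path q.
Proof.
move=> [rp qp wq]; rewrite !lpa_pathE rp qp wq; apply: walk_mono_cat.
by rewrite -wq -qp; exact: (gpathP q).
Qed.

Lemma path_cat_ter p r q : is_cat p r q -> path_ter q = path_ter r.
Proof.
move=> [rp qp wq].
by rewrite [LHS]/path_ter qp wq [LHS]walk_end_cat [RHS]/path_ter rp.
Qed.

Lemma lpa_path_starM p q : path_org p = path_org q ->
  [\/ exists2 r, is_cat p r q & ((lpa_path p)^* * lpa_path q)%lpa = lpa_path r,
      exists2 r, is_cat q r p & ((lpa_path p)^* * lpa_path q = (lpa_path r)^*)%lpa
    | ((lpa_path p)^* * lpa_path q)%lpa = 0].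
Proof.
have walk_suffix v s t : is_walk v (s ++ t) ->
    exists r, [/\ path_org r = walk_end v s, word r = t &
      lpa_path r = walk_mono (walk_end v s) t].
  rewrite is_walk_cat => /andP[_ wt].
  by exists (@GPath G (walk_end v s, t) wt); split=> //; rewrite lpa_pathE.
move=> pq; have wp : is_walk _ (word p) := gpathP p.
have wq : is_walk _ (word q) := gpathP q.
rewrite -[(gpath_val p).1]/(path_org p) pq in wp.
rewrite -[(gpath_val q).1]/(path_org q) in wq.
rewrite !lpa_pathE pq.
case: (walk_mono_starM wp wq) => [[t et ->]|[t et ->]|->]; last exact: Or33.
- rewrite et in wq; have [r [ro rw <-]] := walk_suffix _ _ _ wq.
  by apply: Or31; exists r => //; split; rewrite ?rw // ro /path_ter pq.
- rewrite et in wp; have [r [ro rw <-]] := walk_suffix _ _ _ wp.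
  by apply: Or32; exists r => //; split; rewrite ?rw // ro /path_ter pq.
Qed.

Lemma eq_path p q : path_org p = path_org q -> word p = word q -> p = q.
Proof.
move=> opq wpq; apply: val_inj.
by rewrite /= (surjective_pairing (gpath_val p)) (surjective_pairing (gpath_val q));
  congr pair.
Qed.

(** The list has no duplicates so that the coefficients [k] are those that the trace detects. *)
Definition path_comb (v : vertex G) x :=
  exists (s : seq (gpath G)) (k : gpath G -> int),
  [/\ uniq s, forall p, p \in s -> path_ter p = v
    & x = \sum_(p <- s) lpa_path p *~ k p].

(** Padding with zero coefficients brings two combinations over a common list. *)
Lemma sum_extend (T : eqType) (V : zmodType) (F : T -> V) (k : T -> int)
    (s s' : seq T) :
  uniq s -> uniq s' -> {subset s <= s'} ->
  \sum_(p <- s) F p *~ k p = \sum_(p <- s') F p *~ (if p \in s then k p else 0).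
Proof.
move=> us us' ss'; rewrite [RHS](bigID (mem s)) /=.
rewrite [X in _ + X]big1 => [|p /negbTE ->//].
have ps : perm_eq s [seq p <- s' | p \in s].
  apply: uniq_perm => // [|p]; first exact: filter_uniq.
  by rewrite mem_filter; case: (boolP (p \in s)) => [/ss' ->|].
rewrite addr0 -[RHS]big_filter (perm_big _ ps) /=.
by apply: eq_big_seq => p; rewrite mem_filter => /andP[->].
Qed.

Lemma path_combB v x y : path_comb v x -> path_comb v y -> path_comb v (x - y).
Proof.
move=> [s [k [us sv ->]]] [t [l [ut tv ->]]].
have ust : uniq (undup (s ++ t)) by exact: undup_uniq.
exists (undup (s ++ t)),
  (fun p => (if p \in s then k p else 0) - (if p \in t then l p else 0)).
split=> //.
  by move=> p; rewrite mem_undup mem_cat => /orP[/sv|/tv].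
rewrite (sum_extend _ _ us ust) => [|p ps]; last by rewrite mem_undup mem_cat ps.
rewrite (sum_extend _ _ ut ust) => [|p ps]; last first.
  by rewrite mem_undup mem_cat ps orbT.
by rewrite -sumrB; apply: eq_bigr => p _; rewrite mulrzBr.
Qed.

Lemma path_comb0 v : path_comb v 0.
Proof. by exists [::], (fun=> 0); rewrite big_nil. Qed.

Lemma path_comb1 p : path_comb (path_ter p) (lpa_path p).
Proof.
exists [:: p], (fun=> 1); split=> //; last by rewrite big_seq1.
by move=> q; rewrite inE => /eqP ->.
Qed.

(** Being odd, [u] is nonzero, so $u^2\le 1$ leaves only the two signs and nothing for [S]. *)
Lemma odd_sqr_sum1 (u j S : int) : u = j * 2 - 1 -> 0 <= S -> u ^+ 2 + S = 1 ->
  (u = 1 \/ u = -1) /\ S = 0.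
Proof.
rewrite expr2 => uj S0 uS.
have u1 : u <= 1 by nia.
have u2 : -1 <= u by nia.
have u12 : u = 1 \/ u = -1 by lia.
by split=> //; case: u12 uS => ->; lia.
Qed.

(* Comparing coefficients of the end vertex of [b] in [(xb)^*(xb) = b^*b], the
   integer coefficients of [xb] have squares summing to [1]; that of [b] is odd. *)
Lemma isometry_sign x y b : path_comb (path_ter b) y ->
  (x * lpa_path b)%lpa = y *~ 2 - lpa_path b ->
  (x^* * x)%lpa = lpa_vertex (path_org b) ->
  exists k : int, (k = 1 \/ k = -1) /\ (x * lpa_path b)%lpa = lpa_path b *~ k.
Proof.
move=> [t [l [ut tv ->]]] xb xx.
(* The path [b] need not occur in [y]; its coefficient there is then 0, and the one in $xb$ is
   $-1$. *)
pose s := undup (b :: t); pose k p := if p \in t then l p else 0.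
have us : uniq s by exact: undup_uniq.
have bs : b \in s by rewrite mem_undup inE eqxx.
have sv p : p \in s -> path_ter p = path_ter b.
  by rewrite mem_undup inE => /orP[/eqP ->|/tv].
pose m p : int := k p * 2 - (p == b)%:R.
have {}xb : (x * lpa_path b)%lpa = \sum_(p <- s) lpa_path p *~ m p.
  rewrite xb (sum_extend _ _ ut us) => [|p pt]; last first.
    by rewrite mem_undup inE pt orbT.
  under [RHS]eq_bigr => p _ do rewrite mulrzBr mulrzA.
  rewrite sumrB; congr (_ - _); first by rewrite -mulrz_suml.
  rewrite (bigD1_seq b) //= eqxx big1 ?addr0 ?mulr1z // => p /negbTE ->.
  by rewrite mulr0z.
have [tau tauE] := vertex_trace (path_ter b).
have sqr1 : \sum_(p <- s) m p ^+ 2 = 1.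
  have : tau ((x * lpa_path b)^* * (x * lpa_path b))%lpa = 1.
    rewrite lpa_starM -lpa_mulA (lpa_mulA x^*%lpa) xx lpa_path_org.
    by rewrite tauE // eqxx.
  move=> <-; rewrite xb (raddf_sum (@lpa_star G)) lpa_mul_suml raddf_sum.
  have cross p q : p \in s -> q \in s ->
      tau ((lpa_path p *~ m p)^* * (lpa_path q *~ m q))%lpa =
      m p * m q * (p == q)%:R.
    move=> ps qs; rewrite (raddfMz (@lpa_star G)) lpa_Mzmul lpa_mulMz !raddfMz.
    by rewrite tauE ?sv // !mulrzz; ring.
  apply: eq_big_seq => p ps; rewrite lpa_mul_sumr raddf_sum (bigD1_seq p) //=.
  rewrite big1_seq => [|q /andP[/negbTE qp qs]]; last first.
    by rewrite cross // eq_sym qp mulr0.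
  by rewrite cross // eqxx mulr1 addr0 expr2.
have [k0 km] : exists j, m b = j * 2 - 1 by exists (k b); rewrite /m eqxx.
rewrite (bigD1_seq b) //= in sqr1.
have ge0 : 0 <= \sum_(p <- s | p != b) m p ^+ 2.
  by apply: sumr_ge0 => p _; exact: sqr_ge0.
have [mb /eqP] := odd_sqr_sum1 km ge0 sqr1.
rewrite psumr_eq0 => [/allP m0|p _]; last exact: sqr_ge0.
exists (m b); split=> //; rewrite xb (bigD1_seq b) //= big_seq_cond big1 ?addr0 //.
move=> p /andP[/m0 /implyP h /h]; rewrite sqrf_eq0 => /eqP ->.
by rewrite mulr0z.
Qed.

End Paths.

(** * The rooted algebra and the maximal bases given by cuts *)

Section RootedLpaTheory.
Variables (G : digraph) (R : vertex G).
Implicit Types (p q r b : gpath G) (x y : lpa G).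

Lemma rlpa_sub : is_submodule (rlpa R).
Proof.
split; first by move=> M [[M0 _] _].
by move=> x y xR yR M MP; have [[_ MB] _] := MP; apply: MB; [exact: xR|exact: yR].
Qed.

Lemma rlpa_gen p q : path_org p = R -> path_org q = R -> path_ter p = path_ter q ->
  rlpa R (lpa_path p * (lpa_path q)^*)%lpa.
Proof. by move=> pR qR pq M [_]; apply; exists p, q; split. Qed.

Lemma rlpa_ind (M : set (lpa G)) : is_submodule M ->
  (forall p q, path_org p = R -> path_org q = R -> path_ter p = path_ter q ->
     M (lpa_path p * (lpa_path q)^*)%lpa) ->
  forall x, rlpa R x -> M x.
Proof.
move=> Msub Mgen x; apply; split=> // _ [p [q [pR qR pq ->]]].
exact: Mgen.
Qed.

Lemma rlpaD x y : rlpa R x -> rlpa R y -> rlpa R (x + y).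
Proof.
have [R0 RB] := rlpa_sub.
by move=> xR yR; rewrite -[y]opprK -[- y]sub0r; apply: (RB) => //; exact: RB.
Qed.

Lemma rlpa_unit : rlpa R (lpa_vertex R).
Proof.
pose e : gpath G := @GPath G (R, [::]) isT.
have := @rlpa_gen e e erefl erefl erefl.
by rewrite lpa_pathE /= lpa_star_vertex lpa_vertexK.
Qed.

Lemma rlpa_mul1l y : rlpa R y -> (lpa_vertex R * y)%lpa = y.
Proof.
apply: (rlpa_ind (M := fun y => (lpa_vertex R * y)%lpa = y)).
  by split=> [|x z xE zE]; rewrite ?lpa_mul0 // lpa_mulBr xE zE.
by move=> p q <- _ _; rewrite lpa_mulA lpa_path_org.
Qed.

Lemma rlpa_mul1r y : rlpa R y -> (y * lpa_vertex R)%lpa = y.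
Proof.
apply: (rlpa_ind (M := fun y => (y * lpa_vertex R)%lpa = y)).
  by split=> [|x z xE zE]; rewrite ?lpa_0mul // lpa_mulBl xE zE.
move=> p q _ <- _; rewrite -lpa_mulA -[lpa_vertex _]lpa_star_vertex.
by rewrite -lpa_starM lpa_path_org.
Qed.

(** Keeps the summands of $y_+$ and $y_-$ in $L$. On a generator $pq^*$ the factor $b^*p$ is a path,
    the star of a path or 0; a path is absorbed by $b$, a star by $q^*$. *)
Lemma rlpa_mul_proj b y : path_org b = R -> rlpa R y ->
  rlpa R (lpa_path b * (lpa_path b)^* * y)%lpa.
Proof.
move=> bR; have [R0 RB] := rlpa_sub.
apply: (rlpa_ind (M := fun y => rlpa R (lpa_path b * (lpa_path b)^* * y)%lpa)).
  by split=> [|x z xR zR]; rewrite ?lpa_mul0 // lpa_mulBr; exact: RB.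
move=> p q pR qR pq; rewrite -lpa_mulA (lpa_mulA (lpa_path b)^*%lpa).
have [|[r bp ->]|[r pb ->]|->] := @lpa_path_starM _ b p; first by rewrite pR.
- by rewrite lpa_mulA (path_catM bp); exact: rlpa_gen.
- have [rp _ _] := pb; have [c qc] : exists c, is_cat q r c.
    by apply: path_cat_exists; rewrite -pq.
  rewrite -lpa_starM (path_catM qc); apply: rlpa_gen => //.
    by have [_ -> _] := qc.
  by rewrite (path_cat_ter pb) (path_cat_ter qc).
- by rewrite lpa_0mul lpa_mul0.
Qed.

Definition cut_path N b := path_org b = R /\ word b \in cut N R.

(** For a generator $pq^*$ take the depth $|q|$: no basis element is then a proper prefix of $q$, so
    $q^*b$ is a path or 0. All larger depths are included so that a difference can use the maximum
    of two depths. *)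
Lemma rlpa_mul_cut y : rlpa R y -> exists N, forall M, (N <= M)%N ->
  forall b, cut_path M b -> path_comb (path_ter b) (y * lpa_path b)%lpa.
Proof.
apply: (rlpa_ind (M := fun y => exists N, forall M, (N <= M)%N ->
  forall b, cut_path M b -> path_comb (path_ter b) (y * lpa_path b)%lpa)).
  split=> [|x z [N xN] [K zK]].
    by exists 0%N => M _ b _; rewrite lpa_0mul; exact: path_comb0.
  exists (maxn N K) => M; rewrite geq_max => /andP[NM KM] b bM.
  by rewrite lpa_mulBl; apply: path_combB; [exact: (xN M)|exact: (zK M)].
move=> p q pR qR pq; exists (size (word q)) => M qM b [bR bM].
have caseqb r : is_cat q r b ->
    path_comb (path_ter b) (lpa_path p * lpa_path r)%lpa.
  move=> qb; have [rq _ _] := qb; have [c pc] : exists c, is_cat p r c.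
    by apply: path_cat_exists; rewrite pq.
  by rewrite (path_catM pc) (path_cat_ter qb) -(path_cat_ter pc); exact: path_comb1.
rewrite -lpa_mulA; have [|[r qb ->]|[r bq ->]|->] := @lpa_path_starM _ q b.
- by rewrite qR.
- exact: caseqb.
(* Here $b$ is a prefix of $q$, which forces $q=b$ with an empty remainder. This remainder is its
   own star, so the previous case applies. *)
- have [rb qb wq] := bq; have r0 : word r = [::].
    apply: (cut_prefix_free _ _ bM); last by left; rewrite -wq.
    by rewrite -wq -qR; exact: (gpathP q).
  have eqb : q = b by apply: eq_path => //; rewrite wq r0 cats0.
  have -> : ((lpa_path r)^* = lpa_path r)%lpa.
    by rewrite lpa_pathE r0 /= lpa_star_vertex.
  by apply: caseqb; rewrite {1}eqb -{2}eqb.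
- by rewrite lpa_mul0; exact: path_comb0.
Qed.

Definition cut_paths N : seq (gpath G) := pmap insub [seq (R, t) | t <- cut N R].

Lemma mem_cut_paths N b : b \in cut_paths N <-> cut_path N b.
Proof.
rewrite mem_pmap_sub; split=> [/mapP[t tN bt]|[bR bN]].
  by rewrite /cut_path /path_org /word [gpath_val b]bt.
apply/mapP; exists (word b) => //.
by rewrite /= (surjective_pairing (gpath_val b)) -bR.
Qed.

Lemma cut_paths_uniq N : uniq (cut_paths N).
Proof.
by rewrite pmap_sub_uniq // map_inj_uniq ?cut_uniq // => s t [].
Qed.

Lemma cut_paths_sum N :
  \sum_(b <- cut_paths N) (lpa_path b * (lpa_path b)^*)%lpa = lpa_vertex R.
Proof.
rewrite -(cut_sum N).
under eq_bigr => b _ do rewrite lpa_pathE.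
pose F (u : vertex G * seq (edge G)) :=
  (walk_mono u.1 u.2 * (walk_mono u.1 u.2)^*)%lpa.
transitivity (\sum_(u <- [seq (R, t) | t <- cut N R]) F u); last by rewrite big_map.
transitivity (\sum_(u <- map val (cut_paths N)) F u); first by rewrite big_map.
(* All words of a cut are walks, so [insub] discards none of them. *)
congr bigop; rewrite pmap_filter; last exact: insubK.
apply/all_filterP/allP => u /mapP[t tN ->]; rewrite isSome_insub.
exact: cut_walk tN.
Qed.

(** Independence is the prefix-freeness of the cut. For maximality, any path from the root is
    comparable with a member of the cut, so an independent superset contains no further path. *)
Lemma cut_path_basis N : finite_maximal_basis R (cut_path N).
Proof.
have indep p q : cut_path N p -> cut_path N q -> path_prefix p q -> p = q.
  move=> [pR pN] [qR qN] [r [_ qp wq]].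
  have r0 : word r = [::].
    apply: (cut_prefix_free _ _ pN); last by right; rewrite -wq.
    by rewrite -wq -qR; exact: (gpathP q).
  by apply: eq_path => //; rewrite wq r0 cats0.
split=> //.
- have -> : cut_path N = [set` cut_paths N].
    by apply/seteqP; split=> b /=; rewrite mem_cut_paths.
  exact: finite_seq.
- by move=> b [].
move=> A AR Aind BA; apply/seteqP; split=> // a Aa.
have aR : path_org a = R := AR _ Aa.
have wa : is_walk R (word a) by rewrite -aR; exact: (gpathP a).
have [t tN [u tu]] := cut_comparable N wa.
pose b : gpath G := @GPath G (R, t) (cut_walk tN).
have bN : cut_path N b by [].
case: tu => tu.
- have wu : is_walk (path_ter b) u.
    by move: wa; rewrite tu is_walk_cat => /andP[].
  suff -> : a = b by [].
  apply/esym/Aind => //; first exact: BA.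
  by exists (@GPath G (path_ter b, u) wu).
- have wu : is_walk (path_ter a) u.
    by move: (cut_walk tN); rewrite tu is_walk_cat /path_ter aR => /andP[].
  suff -> : a = b by [].
  apply: Aind => //; first exact: BA.
  by exists (@GPath G (path_ter a, u) wu).
Qed.

End RootedLpaTheory.

(** * Diagonal unitaries as signed sums of the projections of a basis *)

Theorem lemma12 (G : digraph) (R : vertex G) (hR : is_root R)
    (x : lpa G) (hx : unitary R x) :
  diag_unitary R x <->
  exists (B : set (gpath G)) (kappa : gpath G -> int),
    [/\ finite_maximal_basis R B,
        forall b, B b -> kappa b = 1 \/ kappa b = -1
      & x = \sum_(b \in B) (lpa_path b * (lpa_path b)^*)%lpa *~ kappa b].
Proof.
have [xR xxs xsx] := hx.
split=> [[[_ [_ xs]] xdiag]|[B [kappa [[Bfin BR Bind _] kappa1 xE]]]].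
  (* Splitting the unit as $R=P+Q$ gives $x=xR=P-Q=2P-R$. *)
  have [P [Q [PR QR PQ xP xQ]]] := xdiag _ (@rlpa_unit G R).
  have [N PN] := rlpa_mul_cut PR.
  have xPQ : x = P - Q.
    rewrite -[LHS](rlpa_mul1r xR) PQ.
    by rewrite (raddfD (lpa_mul x)) /= xP xQ.
  (* Outside the basis the condition is empty, and 0 is a dummy witness. *)
  have /choice[kappa kappaP] b : exists k : int, cut_path R N b ->
      (k = 1 \/ k = -1) /\ (x * lpa_path b)%lpa = lpa_path b *~ k.
    have [bN|] := pselect (cut_path R N b); last by exists 0.
    have [bR _] := bN.
    have [||k kP] := isometry_sign (x := x) (PN N (leqnn N) b bN).
    - have -> : x = P *~ 2 - lpa_vertex R.
        by rewrite xPQ PQ -[2]/(1 + 1) mulrzDr mulr1z opprD addrACA subrr add0r.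
      by rewrite lpa_mulBl lpa_Mzmul -bR lpa_path_org.
    - by rewrite bR.
    by exists k.
  exists (cut_path R N), kappa; split; first exact: cut_path_basis.
    by move=> b /kappaP[].
  have -> : cut_path R N = [set` cut_paths R N].
    by apply/seteqP; split=> b /=; rewrite mem_cut_paths.
  rewrite -(fsbig_seq _ _ (cut_paths_uniq R N)).
  (* $x=xR=\sum xbb^*$ over the basis. *)
  rewrite -[LHS](rlpa_mul1r xR) -(cut_paths_sum R N) lpa_mul_sumr.
  apply: eq_big_seq => b /mem_cut_paths /kappaP[_ xb].
  by rewrite lpa_mulA xb lpa_Mzmul.
pose l : seq (gpath G) := fset_set B.
have ul : uniq l by exact: fset_uniq.
have lB b : b \in l -> B b by rewrite in_fset_set // inE.
pose E (b : gpath G) := (lpa_path b * (lpa_path b)^*)%lpa.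
have {}xE : x = \sum_(b <- l) E b *~ kappa b by rewrite xE fsbig_finite.
(* Orthogonal idempotents: $b^*c\ne 0$ would make one of $b$, $c$ a prefix of the other. *)
have EE b c : b \in l -> c \in l -> (E b * E c)%lpa = if b == c then E c else 0.
  move=> /lB bB /lB cB; have bR := BR _ bB; have cR := BR _ cB.
  rewrite /E -lpa_mulA (lpa_mulA (lpa_path b)^*%lpa).
  have [->|bc] := eqVneq b c.
    by rewrite lpa_path_starK lpa_mulA lpa_path_ter.
  have [|[r bcr _]|[r cbr _]|->] := @lpa_path_starM _ b c; first by rewrite bR cR.
  - by case/eqP: bc; apply: Bind => //; exists r.
  - by case/eqP: bc; apply/esym/Bind => //; exists r.
  - by rewrite lpa_0mul lpa_mul0.
have xs : (x^*)%lpa = x.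
  rewrite xE raddf_sum; apply: eq_bigr => b _.
  by rewrite raddfMz /= lpa_starM lpa_starK.
have xEb b : b \in l -> (x * E b)%lpa = E b *~ kappa b.
  move=> bl; rewrite xE lpa_mul_suml (bigD1_seq b) //= lpa_Mzmul EE // eqxx.
  rewrite big1_seq ?addr0 // => c /andP[/negbTE cb cl].
  by rewrite lpa_Mzmul EE // cb mul0rz.
(* $R=xx^*=x^2=\sum\kappa_b^2\,bb^*$, and the signs square to 1. *)
have sumE : \sum_(b <- l) E b = lpa_vertex R.
  rewrite -xxs xs {2}xE lpa_mul_sumr; apply: eq_big_seq => b bl.
  rewrite lpa_mulMz xEb // -mulrzA.
  by case: (kappa1 _ (lB _ bl)) => ->; rewrite ?mulrNN mulr1.
split=> // y yR.
(* The sum $y=\sum bb^*y$ is grouped by sign, as $x$ multiplies the summand of $b$ by $\kappa_b$. *)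
exists (\sum_(b <- l | kappa b == 1) (E b * y)%lpa),
  (\sum_(b <- l | kappa b != 1) (E b * y)%lpa).
have rlpa_sum (A : pred (gpath G)) : rlpa R (\sum_(b <- l | A b) (E b * y)%lpa).
  rewrite big_seq_cond; elim/big_ind: _ => [|u v|b /andP[/lB /BR bR _]].
  - by have [] := rlpa_sub R.
  - exact: rlpaD.
  - exact: rlpa_mul_proj.
split=> //.
- rewrite -[LHS](rlpa_mul1l yR) -sumE lpa_mul_suml.
  by rewrite (bigID (fun b => kappa b == 1)).
- rewrite lpa_mul_sumr big_seq_cond [RHS]big_seq_cond.
  apply: eq_bigr => b /andP[bl /eqP k1].
  by rewrite lpa_mulA xEb // k1 mulr1z.
- rewrite lpa_mul_sumr -sumrN big_seq_cond [RHS]big_seq_cond.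
  apply: eq_bigr => b /andP[bl k1].
  rewrite lpa_mulA xEb //; case: (kappa1 _ (lB _ bl)) k1 => -> //.
  by rewrite lpa_Mzmul mulrNz mulr1z.
Qed.
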